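(* Let $g:X\to Y$ be a non-surjective closed continuous map of finite topological spaces such that (i) $g$ has a fibre with two points which are bounded above but not below (in the specialisation preorder of that fibre), and (ii) the image of $g$ is not a clopen subset of $Y$. Then a Hausdorff space $K$ is compact if and only if the map $K\to\{\bullet\}$ belongs to $\{g\}^{lr}$.
   Context: All maps are continuous; classes are computed in the category of all topological spaces. $\{\bullet\}$ is the one-point space. The specialisation preorder on a space is given by $c\leqslant o$ iff $c$ lies in the closure of $\{o\}$; thus (i) says that for some $y\in Y$ the fibre $F=g^{-1}(y)$ contains points $a,b$ such that there is $u\in F$ with $a,b\in\overline{\{u\}}$, but there is no $d\in F$ with $d\in\overline{\{a\}}\cap\overline{\{b\}}$. For maps $f:A\to B$, $g:X\to Y$, $f\pitchfork g$ means: for all $t:A\to X$, $s:B\to Y$ with $g\circ t=s\circ f$ there is $h:B\to X$ with $h\circ f=t$ and $g\circ h=s$. For a class $P$ of maps, $P^l=\{f:\ f\pitchfork g \text{ for all } g\in P\}$, $P^r=\{g:\ f\pitchfork g\text{ for all } f\in P\}$, $P^{lr}=(P^l)^r$. *)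

(* Defs.v *)
From HB Require Import structures.
From mathcomp Require Import all_boot all_order all_algebra.
From mathcomp Require Import all_classical all_reals all_analysis.

Set Implicit Arguments.
Unset Strict Implicit.
Unset Printing Implicit Defensive.

Local Open Scope classical_set_scope.

(* Plain predicates are used rather than [set] over a record of maps: such a
   record lives one universe above [topologicalType], hence cannot be a carrier
   of [set]. *)
Definition map_class : Type :=
  forall A B : topologicalType, continuousType A B -> Prop.

Definition lifts (A B X Y : topologicalType)
    (f : continuousType A B) (g : continuousType X Y) : Prop :=
  forall (t : continuousType A X) (s : continuousType B Y),
    g \o t =1 s \o f ->
    exists h : continuousType B X, h \o f =1 t /\ g \o h =1 s.

Definition left_orth (P : map_class) : map_class :=
  fun A B f => forall (X Y : topologicalType) (g : continuousType X Y),
    P X Y g -> lifts f g.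

Definition right_orth (P : map_class) : map_class :=
  fun X Y g => forall (A B : topologicalType) (f : continuousType A B),
    P A B f -> lifts f g.

Variant singleton_class (X Y : topologicalType) (g : continuousType X Y) :
    forall A B : topologicalType, continuousType A B -> Prop :=
  | In_singleton_class : singleton_class g g.

Definition closed_map (X Y : topologicalType) (g : X -> Y) : Prop :=
  forall C : set X, closed C -> closed (g @` C).

Definition spec_le (T : topologicalType) (c o : T) : Prop := closure [set o] c.

(* [fibre g y] coerces to the subtype of its points; as a [topologicalType] the
   latter carries the subspace topology. *)
Definition fibre (X Y : topologicalType) (g : X -> Y) (y : Y) : set X :=
  g @^-1` [set y].

Definition bounded_above_not_below (T : topologicalType) (a b : T) : Prop :=
  (exists u : T, spec_le a u /\ spec_le b u) /\
  ~ (exists d : T, spec_le d a /\ spec_le d b).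

Definition one_point : topologicalType := discrete_topology unit.

Definition to_point (K : topologicalType) : continuousType K one_point :=
  cst (tt : one_point).

(* Main.v *)
(** Let f : A -> B lift against g. Some y1 outside the image of g has a point
    y0 of the image in its closure; mapping an open set of B disjoint from the
    image of f to y1 and the rest to y0 shows that f has dense image. Mapping
    two disjoint closed subsets of A to a and b, and the rest to an upper bound
    u, shows that their images in B have disjoint closures. By Taimanov's
    argument every map from A to a compact Hausdorff space then extends
    along f.

    Conversely, adjoin to the discrete space on K a point to which a given
    ultrafilter converges. The inclusion of K lifts against every closed map
    with finite fibres, and extending the identity of K along it produces a
    limit of the ultrafilter. *)
Require Import Defs.
From HB Require Import structures.
From mathcomp Require Import all_boot all_order all_algebra.
From mathcomp Require Import all_classical all_reals all_analysis.

Local Open Scope classical_set_scope.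

Lemma spec_le_continuous {S T : topologicalType} {f : S -> T} {c o : S} :
  continuous f -> spec_le c o -> spec_le (f c) (f o).
Proof. by move=> cf co N /cf /co[_ [-> Nfo]]; exists (f o). Qed.

Lemma spec_le_val {T : topologicalType} {F : set T} (c o : F) :
  spec_le (\val c) (\val o) -> spec_le c o.
Proof.
move=> co N [_ [[W oW <-] /= Wc WN]].
have [_ [-> Wo]] := co _ (open_nbhs_nbhs (conj oW Wc)).
by exists o; split=> //; exact: WN.
Qed.

Definition fan_map {T U : Type} (Za Zb : set T) (a b u : U) (z : T) : U :=
  if `[< Za z >] then a else if `[< Zb z >] then b else u.

(** A neighbourhood of [a] or of [b] also contains [u], so it is enough that each point of one
    closed set has a neighbourhood missing the other. *)
Lemma fan_map_continuous {T U : topologicalType} {Za Zb : set T} {a b u : U} :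
  closed Za -> closed Zb -> Za `&` Zb = set0 -> spec_le a u -> spec_le b u ->
  continuous (fan_map Za Zb a b u).
Proof.
move=> cZa cZb ab0 au bu z N; rewrite /fan_map nbhs_simpl/=.
have nu c : spec_le c u -> nbhs c N -> N u by move=> cu /cu[_ [-> ]].
have off Z : closed Z -> ~ Z z -> \near z, ~ Z z.
  by move=> cZ nZ; apply: (open_nbhs_nbhs (conj (closed_openC cZ) nZ)).
case: asboolP => [Zaz Na|nZa].
  have nZb : ~ Zb z by move=> Zbz; have : set0 z by rewrite -ab0.
  apply: filterS (off _ cZb nZb) => w nZbw /=; rewrite (asboolF nZbw).
  by case: asboolP => _; [exact: nbhs_singleton | exact: nu au Na].
case: asboolP => [Zbz Nb|nZb Nu].
  apply: filterS (off _ cZa nZa) => w nZaw /=; rewrite (asboolF nZaw).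
  by case: asboolP => _; [exact: nbhs_singleton | exact: nu bu Nb].
apply: filterS2 (off _ cZa nZa) (off _ cZb nZb) => w nZaw nZbw /=.
by rewrite (asboolF nZaw) (asboolF nZbw); exact: nbhs_singleton.
Qed.

(** The value [h b] is the unique cluster point of [G b], the filter generated by the images under
    [t] of the traces of neighbourhoods of [b]. Density makes [G b] proper, and compactness gives
    existence. *)
Lemma taimanov_extension {A B K : topologicalType} (f : A -> B) (t : A -> K) :
    continuous t -> compact [set: K] -> hausdorff_space K -> dense (range f) ->
    (forall Z1 Z2 : set A, closed Z1 -> closed Z2 -> Z1 `&` Z2 = set0 ->
      closure (f @` Z1) `&` closure (f @` Z2) = set0) ->
  exists2 h : B -> K, continuous h & h \o f =1 t.
Proof.
move=> ct cK hK df sepf.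
have regK : regular_space K by move=> k; exact: compact_regular hK cK filterT.
pose G (b : B) := filter_from (nbhs b) (fun N => t @` (f @^-1` N)).
have GF b : ProperFilter (G b).
  apply: filter_from_proper => [|N].
    apply: filter_from_filter => [|M N bM bN].
      by exists setT; exact: filterT.
    exists (M `&` N); first exact: filterI.
    by move=> _ [a [Ma Na] <-]; split; exists a.
  rewrite nbhsE => -[U [oU Ub] UN].
  have [c [Uc [a _ fa]]] : U `&` range f !=set0 by apply: df => //; exists b.
  by exists (t a), a => //=; apply: UN; rewrite fa.
have clusterG_uniq b k l : cluster (G b) k -> cluster (G b) l -> k = l.
  move=> bk bl; apply: hK => P Q kP lQ.
  (* If [P] and [Q] were disjoint, the preimages of the closures of [P'] and [Q'] would be disjoint
     closed sets whose images both have [b] in their closure. *)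
  have [P' kP' P'P] := regK k P kP; have [Q' lQ' Q'Q] := regK l Q lQ.
  apply/set0P/eqP => PQ0.
  have closed_pre (Z : set K) : closed (t @^-1` closure Z).
    by apply: preimage_closed; [move=> ? _; exact: ct | exact: closed_closure].
  have touch (Z : set K) m : nbhs m Z -> cluster (G b) m ->
      closure (f @` (t @^-1` closure Z)) b.
    move=> mZ bm N bN.
    have [|_ [[a Na <-] Zta]] := bm (t @` (f @^-1` N)) Z _ mZ.
      by exists N.
    by exists (f a); split=> //; exists a => //; exact: subset_closure.
  suff : set0 b by [].
  rewrite -(sepf _ _ (closed_pre P') (closed_pre Q')).
    by split; [exact: touch bk | exact: touch bl].
  rewrite -preimage_setI; apply/seteqP; split=> // a [/P'P Pa /Q'Q Qa].
  by have : set0 (t a) by rewrite -PQ0.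
have /choice[h hG] : forall b, exists k, cluster (G b) k.
  by move=> b; have [k [_ bk]] := cK (G b) (GF b) filterT; exists k.
exists h => [|a] /=; last first.
  apply: clusterG_uniq (hG _) _ => S N [M faM MS] taN.
  exists (t a); split; last exact: nbhs_singleton.
  by apply: MS; exists a => //; exact: (nbhs_singleton faM).
move=> b W hW; have [V hV VW] := regK _ _ hW; rewrite nbhs_simpl/=.
(* By compactness a filter with a single cluster point converges to it. *)
have [N bN NV] : G b V.
  suff : G b --> h b by exact.
  apply: compact_cluster_set1 hK cK filterT _ filterT _.
  by apply/seteqP; split=> [k bk|_ ->//]; exact: clusterG_uniq bk (hG b).
move: bN; rewrite nbhsE => -[U [oU Ub] UN].
exists U => // c Uc.
(* The same [U] serves every [c] in it: [V] lies in [G c], so the cluster point [h c] is in the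
   closure of [V]. *)
apply: VW => M hM; apply: (hG c V M _ hM).
exists U; first exact: (open_nbhs_nbhs (conj oU Uc)).
by move=> _ [a Ua <-]; apply: NV; exists a => //; exact: UN.
Qed.

Lemma lifts_dense {A B X Y : topologicalType} {f : continuousType A B}
    {g : continuousType X Y} {x0 : X} {y1 : Y} :
  ~ range g y1 -> spec_le (g x0) y1 -> lifts f g -> dense (range f).
Proof.
move=> gy1 x0y1 fg O [b Ob] oO; apply/set0P/eqP => Of0.
have cO := open_closedC oO.
(* With an empty second set, this map is [y1] on [O] and [g x0] elsewhere, hence constantly [g x0]
   on the image of [f]. *)
have cs := fan_map_continuous cO closed0 (setI0 _) x0y1 x0y1.
have [|h [_ gh]] := fg (cst x0) (mkcts cs).
  move=> a; rewrite /= /mkcts /fan_map; case: asboolP => // /contrapT Ofa.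
  by have : set0 (f a) by rewrite -Of0; split=> //; exists a.
apply: gy1; exists (h b) => //; have := gh b.
by rewrite /= /mkcts /fan_map !asboolF//; move/(_ Ob).
Qed.

(** Lifting over the constant map to [y] keeps [h] inside the fibre. By continuity its value at a
    common point of the two closures would be a lower bound of [a] and [b]. *)
Lemma lifts_separates_closed {A B X Y : topologicalType}
    {f : continuousType A B} {g : continuousType X Y} {y : Y} {a b : fibre g y}
    {Z1 Z2 : set A} :
  bounded_above_not_below a b -> lifts f g ->
  closed Z1 -> closed Z2 -> Z1 `&` Z2 = set0 ->
  closure (f @` Z1) `&` closure (f @` Z2) = set0.
Proof.
move=> [[u [au bu]] nd] fg cZ1 cZ2 Z12.
have val_cts : continuous (\val : fibre g y -> X).
  exact: (@initial_continuous (fibre g y) X set_val).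
have ct := fan_map_continuous cZ1 cZ2 Z12
  (spec_le_continuous val_cts au) (spec_le_continuous val_cts bu).
have in_fibre (v : fibre g y) : g (\val v) = y by case: v => x /= /set_mem.
have [|h [hf gh]] := fg (mkcts ct) (cst y).
  move=> z /=; rewrite /mkcts /fan_map.
  by case: `[< _ >]; last case: `[< _ >]; exact: in_fibre.
have below (Z : set A) (c : fibre g y) :
    (forall z, Z z -> h (f z) = \val c) ->
    forall z, closure (f @` Z) z -> spec_le (h z) (\val c).
  move=> Zc z Zz N hN; have := Zz _ (@cts_fun _ _ h z N hN).
  move=> [_ [[w Zw <-] /= Nhfw]].
  by exists (\val c); split=> //; rewrite -(Zc w).
apply/seteqP; split=> // z [Z1z Z2z].
apply: nd; exists (SigSub (mem_set (gh z) : h z \in fibre g y)).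
split; apply: spec_le_val => /=.
  apply: below Z1z => w Zw; have := hf w; rewrite /= => ->.
  by rewrite /mkcts /fan_map asboolT.
apply: below Z2z => w Zw; have := hf w; rewrite /= => ->.
rewrite /mkcts /fan_map asboolF ?asboolT// => Z1w.
by have : set0 w by rewrite -Z12.
Qed.

(** Otherwise the complement of [R] is the finite union of the closures of its points, hence
    closed. *)
Lemma closed_not_open_spec {Y : topologicalType} {R : set Y} :
  finite_set (~` R) -> closed R -> ~ clopen R ->
  exists y0 y1, [/\ R y0, ~ R y1 & spec_le y0 y1].
Proof.
move=> finR cR ncoR; apply: contrapT => nex; apply: ncoR; split=> //.
rewrite -closedC (_ : ~` R = \bigcup_(y in ~` R) closure [set y]).
  by apply: closed_bigcup => // y _; exact: closed_closure.
apply/seteqP; split=> [y Ry|y [y1 Ry1 yy1] Ry].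
  by exists y => //; exact: subset_closure.
by apply: nex; exists y, y1.
Qed.

(* [None] is the added point; the points of T stay isolated. *)
Definition adjoin_limit (T : choiceType) (F : filter_on T) : Type := option T.

Section adjoin_limit_topology.
Context (T : choiceType) (F : filter_on T).
Local Notation TF := (adjoin_limit T F).

Definition adjoin_limit_open : set_system TF :=
  [set O | O None -> (F : set_system T) (Some @^-1` O)].

Lemma adjoin_limit_openT : adjoin_limit_open setT.
Proof. by move=> _; exact: filterT. Qed.

Lemma adjoin_limit_openI : setI_closed adjoin_limit_open.
Proof. by move=> O P oO oP [/oO FO /oP FP]; exact: filterI. Qed.

Lemma adjoin_limit_open_bigU (I : Type) (O : I -> set TF) :
  (forall i, adjoin_limit_open (O i)) -> adjoin_limit_open (\bigcup_i O i).
Proof.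
by move=> oO [i _ /oO]; apply: filterS => x Ox; exists i.
Qed.

HB.instance Definition _ := Choice.copy TF (option T).
HB.instance Definition _ := isOpenTopological.Build TF
  adjoin_limit_openT adjoin_limit_openI adjoin_limit_open_bigU.

Lemma adjoin_limit_openE (O : set TF) :
  open O = (O None -> (F : set_system T) (Some @^-1` O)).
Proof. by []. Qed.

End adjoin_limit_topology.

Lemma discrete_continuous {S : discreteTopologicalType} {T : topologicalType}
  (f : S -> T) : continuous f.
Proof. by apply/continuousP => O _; exact: discrete_open. Qed.

Definition adjoin_limit_inj (T : choiceType) (F : filter_on T) :
    continuousType (discrete_topology T) (adjoin_limit T F) :=
  mkcts (discrete_continuous
    (Some : discrete_topology T -> adjoin_limit T F)).

(** A lift amounts to a point over [s None] to which [t] converges along [F]. *)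
Lemma adjoin_limit_inj_lifts {T : choiceType} {F : set_system T}
    {UF : UltraFilter F} {X Y : topologicalType} {g : continuousType X Y} :
  closed_map g -> (forall y, finite_set (g @^-1` [set y])) ->
  lifts (adjoin_limit_inj T (FilterType F ultra_proper)) g.
Proof.
move=> cg fing t s gt.
have [x gx tx] : exists2 x, g x = s None & t @ F --> x.
  (* Otherwise some closed C disjoint from the fibre over [s None] has its
     preimage in F; then [s None] lies in the closed set g(C). *)
  apply: contrapT => nolim.
  have /choice[V HV] : forall x, exists V : set X,
      g x = s None -> [/\ open V, V x & F (~` (t @^-1` V))].
    move=> x; have [gx|] := pselect (g x = s None); last by exists setT.
    have /existsNP[N] : ~ (t @ F --> x) by move=> tx; apply: nolim; exists x.
    move=> /not_implyP[]; rewrite nbhsE => -[V [oV Vx] VN] nFN.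
    exists V => _; split=> //.
    (* For an ultrafilter, a set outside [F] has its complement in [F]. *)
    case: (in_ultra_setVsetC (t @^-1` V) UF) => // FV.
    by exfalso; apply: nFN; apply: filterS FV => z /VN.
  pose C := \bigcap_(x in g @^-1` [set s None]) ~` V x.
  have cC : closed C.
    by apply: closed_bigI => x /HV[oV _ _]; exact: open_closedC.
  have FC : F (t @^-1` C).
    have /finite_fsetP[D DE] := fing (s None).
    rewrite /C DE preimage_bigcap; apply: filter_bigI => x xD.
    by have /HV[] : (g @^-1` [set s None]) x by rewrite DE.
  have oP : open (s @^-1` (~` (g @` C))).
    apply: open_comp; first by move=> ? _; exact: cts_fun.
    exact/closed_openC/cg.
  have Pn : (s @^-1` (~` (g @` C))) None.
    by move=> [x Cx gx]; have [_ Vx _] := HV x gx; exact: Cx gx Vx.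
  (* Openness at [None] puts in [F] the set of [z] with [s (Some z)] outside [g(C)]; it meets the
     preimage of [C] under [t]. *)
  have [z [Cz nCz]] := filter_ex (filterI FC (oP Pn)).
  by apply: nCz; exists (t z) => //; exact: gt.
pose h (z : adjoin_limit T (FilterType F (@ultra_proper _ _ UF))) :=
    if z is Some a then t a else x.
have ch : continuous h.
  apply/continuousP => O oO; rewrite adjoin_limit_openE => Ox.
  exact: tx (open_nbhs_nbhs (conj oO Ox)).
by exists (mkcts ch); split=> // -[a|//]; exact: gt.
Qed.

Theorem corollary4p6 (X Y : topologicalType) (g : continuousType X Y)
    (finX : finite_set [set: X]) (finY : finite_set [set: Y])
    (g_nonsurj : ~ set_surj [set: X] [set: Y] g)
    (g_closed : closed_map g)
    (g_fibre : exists (y : Y) (a b : fibre g y), bounded_above_not_below a b)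
    (g_image : ~ clopen (range g))
    (K : topologicalType) (K_hausdorff : hausdorff_space K) :
  compact [set: K] <->
  right_orth (left_orth (singleton_class g)) (to_point K).
Proof.
split=> [cK A B f fP t s _|Kr].
  have fg : lifts f g by apply: fP.
  have [_ [y1 [[x0 _ <-] gy1 x0y1]]] : exists y0 y1,
      [/\ range g y0, ~ range g y1 & spec_le y0 y1].
    apply: closed_not_open_spec g_image; last exact/g_closed/closedT.
    exact: sub_finite_set finY.
  have [y [a [b ab]]] := g_fibre.
  have [|||h ch hf] := taimanov_extension f t _ cK K_hausdorff.
  - exact: cts_fun.
  - exact: lifts_dense gy1 x0y1 fg.
  - by move=> Z1 Z2; exact: lifts_separates_closed ab fg.
  by exists (mkcts ch); split=> // z; case: (s z).
rewrite compact_ultra => F UF _.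
have lF : left_orth (singleton_class g)
    (adjoin_limit_inj K (FilterType F ultra_proper)).
  move=> _ _ _ []; apply: adjoin_limit_inj_lifts => // y.
  exact: sub_finite_set finX.
have [//|h [hK _]] := Kr _ _ _ lF
  (mkcts (discrete_continuous (idfun : discrete_topology K -> K))) (cst tt).
(* An open set around [None] has its trace in [F], and [h] is the identity on [K]. *)
exists (h None); split=> // N hN.
have [U [FU U_None UN]] := @cts_fun _ _ h _ _ hN.
rewrite nbhs_simpl/=; apply: filterS (FU U_None) => k /UN /=.
by have /= -> := hK k.
Qed.
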